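(* A $2$-bounded set of reduced, integral, isotropic vectors (vectors being taken up to multiplication by units of $\mathbb{Z}[i]$) is $\Gamma$-conjugate to exactly one of $\mathcal{J}^2_1,\ \mathcal{J}^2_2,\ \mathcal{J}^3_1,\ \mathcal{J}^3_2,\ \mathcal{J}^3_3,\ \mathcal{J}^4_1,\ \mathcal{J}^4_2,$ or $\mathcal{J}^5$.
   Context: Let $H=\begin{pmatrix}0&0&i\\0&-1&0\\-i&0&0\end{pmatrix}$, $G=\mathrm{SU}(2,1)=\{g\in \mathrm{SL}(3,\mathbb{C}) : g^*Hg=H\}$, $\mathcal{Q}(u,v)=u^*Hv$ for $u,v\in\mathbb{C}^3$, and $\Gamma=G\cap \mathrm{SL}_3(\mathbb{Z}[i])$. A vector is integral if it lies in $\mathbb{Z}[i]^3$. An integral vector $v=(n,p,q)^t$ is reduced if $n,p,q$ generate $\mathbb{Z}[i]$ as an ideal, and isotropic if $\mathcal{Q}(v,v)=0$. Vectors $v$ and $\varepsilon v$ with $\varepsilon\in\mathbb{Z}[i]^*=\{\pm1,\pm i\}$ are treated interchangeably; the group $\Gamma$ acts on sets of such vectors (up to units), and two sets are $\Gamma$-conjugate if an element of $\Gamma$ carries one onto the other. A set $\mathcal{J}$ of vectors in $\mathbb{C}^3$ is $c$-bounded if $|\mathcal{Q}(u,v)|^2\le c$ for all $u,v\in\mathcal{J}$. The sets are $\mathcal{J}^2_1=\{(1,0,0)^t,(0,0,1)^t\}$, $\mathcal{J}^2_2=\{(1,0,0)^t,(i,1+i,1+i)^t\}$, $\mathcal{J}^3_1=\mathcal{J}^2_1\cup\{(1,0,1)^t\}$,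 $\mathcal{J}^3_2=\mathcal{J}^2_1\cup\{(i,1+i,1)^t\}$, $\mathcal{J}^3_3=\mathcal{J}^2_1\cup\{(1+i,1+i,1)^t\}$, $\mathcal{J}^4_1=\mathcal{J}^3_1\cup\{(i,1+i,1)^t\}$, $\mathcal{J}^4_2=\mathcal{J}^3_3\cup\{(-1,-1+i,1+i)^t\}$, $\mathcal{J}^5=\mathcal{J}^4_1\cup\{(1+i,1+i,1)^t\}$.
   Formalization: The set is additionally assumed to contain at least two vectors up to units; the empty set and one-vector sets such as {(1,0,0)^t} are 2-bounded but conjugate to none of the listed sets. *)

(* Defs.v *)
From mathcomp Require Import all_boot all_order all_algebra.
From mathcomp Require Import sesquilinear spectral classical_sets reals complex.

Set Implicit Arguments.
Unset Strict Implicit.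
Unset Printing Implicit Defensive.

Import Order.TTheory GRing.Theory Num.Theory.
Local Open Scope ring_scope.
Local Open Scope classical_set_scope.
Local Open Scope sesquilinear_scope.

Section Defs.
Variable C : numClosedFieldType.

Implicit Types (u v w : 'cV[C]_3) (g : 'M[C]_3) (J K : set 'cV[C]_3).

Definition vec3 (x y z : C) : 'cV[C]_3 := \col_(j < 3) nth 0 [:: x; y; z] j.

Definition H : 'M[C]_3 :=
  \matrix_(j < 3, k < 3)
    nth 0 (nth [::] [:: [:: 0;    0;  'i];
                        [:: 0;   -1;   0];
                        [:: -'i;  0;   0]] j) k.

(* [^t*] is the conjugate transpose. *)
Definition Q u v : C := (u^t* *m H *m v) 0 0.

Definition SU21 : set 'M[C]_3 := [set g : 'M[C]_3 | \det g = 1 /\ g^t* *m H *m g = H].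

Definition gaussint : set C :=
  [set z | exists a b : int, z = a%:~R + b%:~R * 'i].

Definition gaussunit : set C := [set z | z \in [:: 1; -1; 'i; -'i]].

Definition SL3_gaussint : set 'M[C]_3 :=
  [set g : 'M[C]_3 | (forall j k, gaussint (g j k)) /\ \det g = 1].

Definition Gamma : set 'M[C]_3 := SU21 `&` SL3_gaussint.

Definition integral v : Prop := forall j, gaussint (v j 0).

(* The ideal of Z[i] generated by the coordinates of an integral vector. *)
Definition coord_ideal v : set C :=
  [set \sum_(j < 3) a j 0 * v j 0 | a in integral].

Definition reduced v : Prop := integral v /\ coord_ideal v = gaussint.

Definition isotropic v : Prop := Q v v = 0.

Definition bounded (c : C) J : Prop :=
  forall u v, J u -> J v -> `|Q u v| ^+ 2 <= c.

(* All unit multiples of elements of [J]: two sets represent the same set of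
   vectors up to units iff their saturations coincide. *)
Definition up_to_units J : set 'cV[C]_3 :=
  [set e *: v | e in gaussunit & v in J].

Definition Gamma_conjugate J K : Prop :=
  exists2 g, Gamma g & up_to_units [set g *m v | v in J] = up_to_units K.

(* [J] has at least two elements, counted up to units. *)
Definition two_up_to_units J : Prop :=
  exists u v, [/\ J u, J v & ~ up_to_units [set v] u].

Definition J2_1 : set 'cV[C]_3 := [set vec3 1 0 0; vec3 0 0 1].
Definition J2_2 : set 'cV[C]_3 := [set vec3 1 0 0; vec3 'i (1 + 'i) (1 + 'i)].
Definition J3_1 := J2_1 `|` [set vec3 1 0 1].
Definition J3_2 := J2_1 `|` [set vec3 'i (1 + 'i) 1].
Definition J3_3 := J2_1 `|` [set vec3 (1 + 'i) (1 + 'i) 1].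
Definition J4_1 := J3_1 `|` [set vec3 'i (1 + 'i) 1].
Definition J4_2 := J3_3 `|` [set vec3 (-1) (-1 + 'i) (1 + 'i)].
Definition J5 := J4_1 `|` [set vec3 (1 + 'i) (1 + 'i) 1].

Definition Jlist : 8.-tuple (set 'cV[C]_3) :=
  [tuple J2_1; J2_2; J3_1; J3_2; J3_3; J4_1; J4_2; J5].

End Defs.

(* Main.v *)
Require Import Defs.
From mathcomp Require Import all_boot all_order all_algebra.
From mathcomp Require Import classical_sets reals complex.
From HB Require Import structures.
From mathcomp Require Import boolp sesquilinear ring zify.

Set Implicit Arguments.
Unset Strict Implicit.
Unset Printing Implicit Defensive.

Import Order.TTheory GRing.Theory Num.Theory.
Local Open Scope ring_scope.

(* Work with integral vectors over Z[i].  If [u], [v] are isotropic with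
   [Q(u,v) = i], then [u], [w], [v] with [w = H conj(u x v)] is a basis of Gram
   matrix [H] and determinant 1, so taking coordinates in it is an element of
   Gamma sending [u], [v] to [e1 = (1,0,0)], [e3 = (0,0,1)].

   If J has a pair with [|Q(u,v)| = 1], we may thus assume that it contains [e1]
   and [e3].  Boundedness against these two leaves 24 vectors up to units, hence
   finitely many cliques for the relation [|Q|^2 <= 2]; each of the 111 cliques
   through [e1] and [e3] is carried to some J_k by the frame of one of its own
   unit pairs, and these frames are searched by computation.

   If J has no such pair, a Euclidean descent on the last coordinate moves one
   vector to [e1].  The other ones then have last coordinate [1 + i] up to units,
   one of them can be moved to [(i, 1+i, 1+i)], and modulo 2 there is no third
   vector.

   The J_k are pairwise inequivalent because [|Q(x,y)|^2] and
   [Q(x,y) Q(y,w) Q(w,x)] are invariant under Gamma and under units. *)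

(* [int[i]] carries no ring structure: the one of [complex] needs a field. *)
Definition gint := int[i].
HB.instance Definition _ := GRing.Zmodule.on gint.

Fact gint_mul1 : left_id (1 +i* 0 : gint)%C (@ComplexField.mulc int).
Proof. by case=> a b; congr Complex; ring. Qed.

Fact gint_mulDl :
  left_distributive (@ComplexField.mulc int) (+%R : gint -> gint -> gint).
Proof. by case=> a b [c d] [e f]; congr Complex => /=; ring. Qed.

HB.instance Definition _ := GRing.Zmodule_isComNzRing.Build gint
  (@ComplexField.mulcA int) (@ComplexField.mulcC int) gint_mul1 gint_mulDl
  isT.

Definition gi : gint := (0 +i* 1)%C.

Lemma gi2 : gi * gi = -1. Proof. by []. Qed.

Definition gconj (z : gint) : gint := let: (a +i* b)%C := z in (a -i* b)%C.

Lemma gconj_is_zmod_morphism : zmod_morphism gconj.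
Proof. by case=> a b [c d]; congr Complex => /=; ring. Qed.
HB.instance Definition _ :=
  GRing.isZmodMorphism.Build gint gint gconj gconj_is_zmod_morphism.

Lemma gconj_is_monoid_morphism : monoid_morphism gconj.
Proof. by split=> // -[a b] [c d]; congr Complex => /=; ring. Qed.
HB.instance Definition _ :=
  GRing.isMonoidMorphism.Build gint gint gconj gconj_is_monoid_morphism.

Lemma gconjK : involutive gconj.
Proof. by case=> a b; rewrite /= opprK. Qed.

Lemma gconj_i : gconj gi = - gi. Proof. by []. Qed.

Arguments gconj : simpl never.

Definition gN (z : gint) : int := let: (a +i* b)%C := z in a ^+ 2 + b ^+ 2.

Lemma gNM x y : gN (x * y) = gN x * gN y.
Proof. by case: x y => a b [c d] /=; ring. Qed.

Lemma gN_conj x : gN (gconj x) = gN x.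
Proof. by case: x => a b; rewrite /gconj /=; ring. Qed.

Lemma gN_ge0 x : 0 <= gN x.
Proof. by case: x => a b; rewrite /gN addr_ge0 ?sqr_ge0. Qed.

Lemma gN_eq0 x : (gN x == 0) = (x == 0).
Proof.
by case: x => a b; rewrite /gN paddr_eq0 ?sqr_ge0 // !sqrf_eq0 [RHS]eq_complex.
Qed.

Definition gunits : seq gint := [:: 1; gi; -1; - gi].

Lemma sqr_le2 (a : int) : a ^+ 2 <= 2 -> a \in [:: -1; 0; 1].
Proof.
rewrite !inE => h; have: -1 <= a <= 1 by nia.
by move=> /andP[? ?]; lia.
Qed.

Definition gbox (s : seq int) : seq gint := [seq (a +i* b)%C | a <- s, b <- s].

Lemma gN_small z : gN z <= 2 -> z \in gbox [:: -1; 0; 1].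
Proof.
case: z => a b /= h; apply: (allpairs_f (fun a b => (a +i* b)%C : gint));
  by apply: sqr_le2; have := sqr_ge0 a; have := sqr_ge0 b; lia.
Qed.

Lemma gunitP e : reflect (gN e = 1) (e \in gunits).
Proof.
apply: (iffP idP) => [|h]; first by rewrite !inE => /or4P[] /eqP->.
have /gN_small : gN e <= 2 by rewrite h.
by move: h; rewrite !inE => h; do !case/orP; move/eqP=> E; move: h; rewrite E.
Qed.

Lemma gunitV e : e \in gunits -> gconj e * e = 1.
Proof. by rewrite !inE => /or4P[] /eqP->. Qed.

Lemma gunit_conj e : (gconj e \in gunits) = (e \in gunits).
Proof. by apply/gunitP/gunitP; rewrite gN_conj. Qed.

Lemma gunitM e f : e \in gunits -> f \in gunits -> e * f \in gunits.
Proof. by move=> /gunitP he /gunitP hf; apply/gunitP; rewrite gNM he hf. Qed.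

Definition gvec := (gint * gint * gint)%type.

Implicit Types (x y u w : gvec) (e z : gint).

Definition gscale e x : gvec := let: (x1, x2, x3) := x in (e * x1, e * x2, e * x3).

Definition gQ x y : gint :=
  let: (x1, x2, x3) := x in let: (y1, y2, y3) := y in
  gi * (gconj x1 * y3) - gconj x2 * y2 - gi * (gconj x3 * y1).

Lemma gscaleA e f x : gscale e (gscale f x) = gscale (e * f) x.
Proof. by case: x => [[a b] c]; rewrite /= !mulrA. Qed.

Lemma gscale1 x : gscale 1 x = x.
Proof. by case: x => [[a b] c]; rewrite /= !mul1r. Qed.

Lemma gscaleK e x : e \in gunits -> gscale (gconj e) (gscale e x) = x.
Proof. by move=> he; rewrite gscaleA gunitV ?gscale1. Qed.

Lemma gQ_conj x y : gconj (gQ x y) = gQ y x.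
Proof.
case: x y => [[x1 x2] x3] [[y1 y2] y3] /=.
by rewrite !rmorphB !rmorphM /= !gconjK gconj_i; ring.
Qed.

Lemma gQ_scale e f x y : gQ (gscale e x) (gscale f y) = gconj e * f * gQ x y.
Proof.
case: x y => [[x1 x2] x3] [[y1 y2] y3] /=; rewrite !rmorphM; ring.
Qed.

Lemma gN_Q_scale e f x y : e \in gunits -> f \in gunits ->
  gN (gQ (gscale e x) (gscale f y)) = gN (gQ x y).
Proof.
by move=> /gunitP he /gunitP hf; rewrite gQ_scale !gNM gN_conj he hf !mul1r.
Qed.

(* [gperp u v = H * conj (u x v)] spans the orthogonal of [u] and [v]. *)
Definition gperp u v : gvec :=
  let: (u1, u2, u3) := u in let: (v1, v2, v3) := v in
  (gi * gconj (u1 * v2 - u2 * v1), gconj (u1 * v3 - u3 * v1),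
   - gi * gconj (u2 * v3 - u3 * v2)).

Lemma gQ_perpl u v : gQ u (gperp u v) = 0.
Proof.
case: u v => [[u1 u2] u3] [[v1 v2] v3] /=.
by rewrite !rmorphB !rmorphM; ring: gi2.
Qed.

Lemma gQ_perpr u v : gQ v (gperp u v) = 0.
Proof.
case: u v => [[u1 u2] u3] [[v1 v2] v3] /=.
by rewrite !rmorphB !rmorphM; ring: gi2.
Qed.

Lemma gQ_perp u v : gQ (gperp u v) (gperp u v) = gQ u u * gQ v v - gQ u v * gQ v u.
Proof.
case: u v => [[u1 u2] u3] [[v1 v2] v3] /=.
rewrite !(rmorphN, rmorphB, rmorphM) /= !gconjK gconj_i.
by ring: gi2.
Qed.

Definition gdet u v w : gint :=
  let: (u1, u2, u3) := u in let: (v1, v2, v3) := v in let: (w1, w2, w3) := w in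
  u1 * (v2 * w3 - w2 * v3) - v1 * (u2 * w3 - w2 * u3) + w1 * (u2 * v3 - v2 * u3).

Lemma gdet_perp u v : gdet u (gperp u v) v = - gQ (gperp u v) (gperp u v).
Proof.
case: u v => [[u1 u2] u3] [[v1 v2] v3] /=.
rewrite !(rmorphN, rmorphB, rmorphM) /= !gconjK gconj_i.
by ring: gi2.
Qed.

(* When [gQ u v = i], the coordinates of [y] in the basis [u, gperp u v, v]. *)
Definition gcoord u v y : gvec := (gi * gQ v y, - gQ (gperp u v) y, - gi * gQ u y).

(** * Embedding Gaussian vectors into the complex ones *)

Section Embedding.
Variable C : numClosedFieldType.
Implicit Types (a b : 'cV[C]_3) (g : 'M[C]_3).
Local Open Scope sesquilinear_scope.

Definition emb (z : gint) : C := let: (a +i* b)%C := z in a%:~R + b%:~R * 'i.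

Lemma emb_is_zmod_morphism : zmod_morphism emb.
Proof. by case=> a b [c d] /=; rewrite !rmorphB; ring. Qed.
HB.instance Definition _ :=
  GRing.isZmodMorphism.Build gint C emb emb_is_zmod_morphism.

Lemma emb_is_monoid_morphism : monoid_morphism emb.
Proof.
split=> [|[a b] [c d]] /=; first by rewrite mul0r addr0.
rewrite rmorphB rmorphD !rmorphM /=; have := sqrCi C; rewrite expr2 => i2.
by ring: i2.
Qed.
HB.instance Definition _ :=
  GRing.isMonoidMorphism.Build gint C emb emb_is_monoid_morphism.

Lemma emb_i : emb gi = 'i.
Proof. by rewrite /= add0r mul1r. Qed.

Lemma emb_conj z : emb (gconj z) = (emb z)^*.
Proof.
case: z => a b; rewrite /gconj /emb [in RHS]rmorphD [in RHS]rmorphM !rmorph_int.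
by rewrite /= conjCi rmorphN mulrN mulNr.
Qed.

Lemma normC_emb z : `|emb z| ^+ 2 = (gN z)%:~R.
Proof.
by case: z => a b; rewrite /emb mulrC normC2_rect ?realz // -!rmorphXn -rmorphD.
Qed.

Lemma emb_inj : injective emb.
Proof.
apply: raddf_inj => z z0; apply/eqP; rewrite -gN_eq0 -(intr_eq0 C) -normC_emb z0.
by rewrite normr0 expr0n.
Qed.

Arguments emb : simpl never.

Lemma gaussintP (c : C) : gaussint c <-> exists z, c = emb z.
Proof.
by split=> [[a [b ->]]|[[a b] ->]]; [exists (a +i* b)%C | exists a, b].
Qed.

Lemma gaussunitP (c : C) : gaussunit c <-> exists2 e, e \in gunits & c = emb e.
Proof.
have -> : gaussunit c = (c \in map emb gunits) :> Prop.
  rewrite /gaussunit /= !rmorphN /= rmorph1 emb_i !inE.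
  by congr (is_true (_ || _)); rewrite orbCA.
by split=> [/mapP|[e he ->]]; [|exact: map_f].
Qed.

Definition embV x : 'cV[C]_3 :=
  let: (x1, x2, x3) := x in vec3 (emb x1) (emb x2) (emb x3).

Lemma sum_ord3 (V : nmodType) (F : 'I_3 -> V) : \sum_i F i = F 0 + F 1 + F 2.
Proof.
by rewrite !big_ord_recr big_ord0 /= add0r /=; congr (F _ + F _ + F _); apply/val_inj.
Qed.

Lemma QE a b :
  Q a b = 'i * ((a 0 0)^* * b 2 0) - (a 1 0)^* * b 1 0 - 'i * ((a 2 0)^* * b 0 0).
Proof.
rewrite /Q !mxE !sum_ord3 !mxE !sum_ord3 !mxE /=; ring.
Qed.

Lemma Q_emb x y : Q (embV x) (embV y) = emb (gQ x y).
Proof.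
case: x y => [[x1 x2] x3] [[y1 y2] y3]; rewrite QE !mxE /=.
by rewrite !(rmorphB, rmorphM) /= emb_i !emb_conj.
Qed.

Lemma embV_inj : injective embV.
Proof.
move=> [[x1 x2] x3] [[y1 y2] y3] /matrixP h.
by congr (_, _, _); apply: emb_inj; [move: (h 0 0)|move: (h 1 0)|move: (h 2 0)];
  rewrite !mxE.
Qed.

Lemma embV_scale e x : embV (gscale e x) = emb e *: embV x.
Proof.
case: x => [[x1 x2] x3]; apply/matrixP => j k; rewrite !mxE.
by case: j => -[|[|[]]] //= _; rewrite rmorphM.
Qed.

Lemma integral_embV a : integral a <-> exists x, a = embV x.
Proof.
split=> [h|[[[x1 x2] x3] ->] j].
  have [x1 h1] := (gaussintP _).1 (h 0).
  have [x2 h2] := (gaussintP _).1 (h 1).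
  have [x3 h3] := (gaussintP _).1 (h 2).
  exists (x1, x2, x3); apply/matrixP => j k; rewrite !mxE ord1.
  by case: j => -[|[|[]]] //= p; [rewrite -h1|rewrite -h2|rewrite -h3];
    congr (a _ _); apply/val_inj.
by apply/gaussintP; rewrite mxE; case: j => -[|[|[]]] //= _; eexists.
Qed.

Lemma gram_col (A : 'M[C]_3) j k : (A^t* *m H C *m A) j k = Q (col j A) (col k A).
Proof.
rewrite /Q !mxE; apply: eq_bigr => l _; rewrite !mxE; congr (_ * _).
by apply: eq_bigr => m _; rewrite !mxE.
Qed.

Lemma Q_SU21 g a b : SU21 g -> Q (g *m a) (g *m b) = Q a b.
Proof.
move=> [_ gH]; rewrite /Q trmx_mul map_mxM /= !mulmxA -(mulmxA _ _ (H C)).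
by rewrite -(mulmxA _ (_ *m _) g) gH.
Qed.
End Embedding.

Arguments emb {C} z : simpl never.
Arguments embV {C} x : simpl never.

Lemma det_mx3 (R : comPzRingType) (A : 'M[R]_3) :
  \det A = A 0 0 * (A 1 1 * A 2 2 - A 1 2 * A 2 1)
         - A 0 1 * (A 1 0 * A 2 2 - A 1 2 * A 2 0)
         + A 0 2 * (A 1 0 * A 2 1 - A 1 1 * A 2 0).
Proof.
rewrite (expand_det_row _ 0) sum_ord3 /cofactor.
rewrite !(expand_det_row _ ord0) !big_ord_recl !big_ord0 /cofactor !det_mx11 !mxE.
have [f E] : exists f : nat -> nat -> R, forall j k, A j k = f j k.
  by exists (fun j k => A (inord j) (inord k)) => j k; rewrite !inord_val.
rewrite !E /= /bump /= !(addn0, add0n, add1n) !exprS expr0.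
ring.
Qed.

Section Frame.
Variable C : numClosedFieldType.
Implicit Types (g h : 'M[C]_3).
Local Open Scope sesquilinear_scope.
Local Notation embV := (@embV C).
Local Notation emb := (@emb C).

Definition gint_mx m n (A : 'M[C]_(m, n)) := forall j k, gaussint (A j k).

Lemma gint_mx_mul n g (h : 'M_(3, n)) : gint_mx g -> gint_mx h -> gint_mx (g *m h).
Proof.
move=> Zg Zh j k; rewrite mxE sum_ord3.
have Z l : exists z, g j l * h l k = emb z.
  have [z1 ->] := (gaussintP _).1 (Zg j l); have [z2 ->] := (gaussintP _).1 (Zh l k).
  by exists (z1 * z2); rewrite rmorphM.
have [z0 ->] := Z 0; have [z1 ->] := Z 1; have [z2 ->] := Z 2.
by apply/gaussintP; exists (z0 + z1 + z2); rewrite !rmorphD.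
Qed.

Lemma gint_mx_adj g : gint_mx g -> gint_mx (g^t*).
Proof.
move=> Zg j k; have [z gz] := (gaussintP _).1 (Zg k j).
by apply/gaussintP; exists (gconj z); rewrite !mxE gz emb_conj.
Qed.

Lemma gint_mx_H : gint_mx (H C).
Proof.
move=> j k; apply/gaussintP; exists (nth 0 (nth [::] [:: [:: 0; 0; gi];
  [:: 0; -1; 0]; [:: - gi; 0; 0]] j) k).
rewrite mxE; case: j k => -[|[|[|//]]] ? [[|[|[|//]]] ?] /=;
  by rewrite ?rmorphN /= ?rmorph0 ?rmorph1 ?emb_i.
Qed.

Lemma Gamma_mul g h : Gamma g -> Gamma h -> Gamma (g *m h).
Proof.
move=> [[dg Hg] [Zg _]] [[dh Hh] [Zh _]]; have dgh : \det (g *m h) = 1.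
  by rewrite det_mulmx dg dh mulr1.
split; split=> //; last exact: gint_mx_mul.
by rewrite trmx_mul map_mxM /= !mulmxA -(mulmxA _ _ (H C)) -(mulmxA _ (_ *m _) g) Hg.
Qed.

Lemma H_mul_H : H C *m H C = 1%:M.
Proof.
apply/matrixP => j k; rewrite !mxE sum_ord3 !mxE.
have := sqrCi C; rewrite expr2 => i2.
by case: j k => -[|[|[|//]]] ? [[|[|[|//]]] ?] /=; ring: i2.
Qed.

Lemma frame u v : gQ u u = 0 -> gQ v v = 0 -> gQ u v = gi ->
  exists2 g, Gamma g & forall y, g *m embV y = embV (gcoord u v y).
Proof.
move=> Quu Qvv Quv.
have Qvu : gQ v u = - gi by rewrite -gQ_conj Quv.
have Qww : gQ (gperp u v) (gperp u v) = -1.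
  by rewrite gQ_perp Quu Quv Qvu; ring: gi2.
have Qwu : gQ (gperp u v) u = 0 by rewrite -gQ_conj gQ_perpl rmorph0.
have Qwv : gQ (gperp u v) v = 0 by rewrite -gQ_conj gQ_perpr rmorph0.
pose W : 'M[C]_3 := \matrix_(j, k) embV (nth u [:: u; gperp u v; v] k) j 0.
have colW k : col k W = embV (nth u [:: u; gperp u v; v] k).
  by apply/matrixP => j l; rewrite !mxE ord1.
have WHW : W^t* *m H C *m W = H C.
  apply/matrixP => j k; rewrite gram_col !colW Q_emb mxE.
  case: j k => -[|[|[|//]]] ? [[|[|[|//]]] ?] /=;
    rewrite ?(Quu, Qvv, Quv, Qvu, Qww, Qwu, Qwv, gQ_perpl, gQ_perpr);
    by rewrite ?rmorphN /= ?emb_i ?rmorph1 ?rmorph0.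
have detW : \det W = 1.
  rewrite det_mx3 !mxE /=.
  have := gdet_perp u v; rewrite Qww opprK => /(congr1 emb); rewrite rmorph1 => <-.
  rewrite /embV; move: (gperp u v) => [[w1 w2] w3].
  case: u v {Quu Qvv Quv Qvu Qww Qwu Qwv W colW WHW} => [[u1 u2] u3] [[v1 v2] v3].
  by rewrite !mxE /= !(rmorphB, rmorphD, rmorphM).
have [g gE] : exists g, g = H C *m W^t* *m H C by eexists.
have gW : g *m W = 1%:M by rewrite gE -!mulmxA (mulmxA _ (H C)) WHW H_mul_H.
have Wg : W *m g = 1%:M by apply: mulmx1C.
exists g.
  have dg : \det g = 1.
    by have := congr1 determinant gW; rewrite det_mulmx detW mulr1 det1.
  split; split=> //.
    rewrite -[in LHS]WHW !mulmxA -(mulmxA _ W g) Wg mulmx1.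
    by rewrite -map_mxM -trmx_mul Wg trmx1 map_mx1 mul1mx.
  rewrite gE; apply: gint_mx_mul; last exact: gint_mx_H.
  apply: (gint_mx_mul gint_mx_H); apply: gint_mx_adj.
  by move=> j k; rewrite mxE; apply: (integral_embV _).2; eexists.
move=> y; rewrite gE -!mulmxA (mulmxA _ (H C)).
have -> : W^t* *m H C *m embV y = \col_k Q (col k W) (embV y).
  by apply/matrixP => j k; rewrite ord1 /Q !mxE; apply: eq_bigr => l _;
     rewrite !mxE; congr (_ * _); apply: eq_bigr => m _; rewrite !mxE.
apply/matrixP => j k; rewrite !mxE sum_ord3 !mxE !colW !Q_emb /=.
by case: j => -[|[|[|//]]] ? /=; rewrite ?(rmorphM, rmorphN) /= ?emb_i; ring.
Qed.

End Frame.

Local Open Scope classical_set_scope.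

(** * Sets of vectors up to units and their transport by Gamma *)

Definition gsat (S : set gvec) : set gvec :=
  [set gscale e x | e in [set` gunits] & x in S].

(* [H] being unimodular, this is a Bezout relation between the coordinates. *)
Definition primitive x := exists z : gvec, gQ z x = 1.

Definition admissible (S : set gvec) :=
  (forall x, S x -> gQ x x = 0 /\ primitive x) /\
  (forall x y, S x -> S y -> gN (gQ x y) <= 2).

Lemma sub_gsat (S : set gvec) : S `<=` gsat S.
Proof. by move=> x Sx; exists 1 => //; exists x => //; rewrite gscale1. Qed.

Lemma gsatK (S : set gvec) : gsat (gsat S) = gsat S.
Proof.
apply/seteqP; split=> [_ [e /= he [_ [f /= hf [x Sx <-]] <-]]|]; last exact: sub_gsat.
by rewrite gscaleA; exists (e * f); [exact: gunitM|exists x].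
Qed.

Lemma gsatS (S T : set gvec) : S `<=` T -> gsat S `<=` gsat T.
Proof. by move=> ST _ [e he [x /ST Tx <-]]; exists e => //; exists x. Qed.

Lemma gsatP (S T : set gvec) : gsat S = gsat T <-> S `<=` gsat T /\ T `<=` gsat S.
Proof.
split=> [ST|[/gsatS ST /gsatS TS]]; last first.
  by apply/seteqP; split; [rewrite -(gsatK T)|rewrite -(gsatK S)].
by split; [rewrite -ST|rewrite ST]; exact: sub_gsat.
Qed.

Lemma gsat_scale (S : set gvec) e x : e \in gunits -> gsat S (gscale e x) <-> gsat S x.
Proof.
move=> he; split=> Sx; rewrite -gsatK; last by exists e => //; exists x.
by exists (gconj e); [rewrite /= gunit_conj|exists (gscale e x); rewrite ?gscaleK].
Qed.

Lemma primitive_scale e x : e \in gunits -> primitive x -> primitive (gscale e x).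
Proof.
move=> he [z zx]; exists (gscale e z).
by rewrite gQ_scale zx mulr1 gunitV.
Qed.

Lemma admissible_gsat S : admissible S -> admissible (gsat S).
Proof.
case=> Sv Sb; split=> [_ [e /= he [x /Sv [xx px] <-]]|].
  by rewrite gQ_scale xx mulr0; split=> //; exact: primitive_scale.
move=> _ _ [e /= he [x Sx <-]] [f /= hf [y Sy <-]].
by rewrite gN_Q_scale //; exact: Sb.
Qed.

Section Transport.
Variable C : numClosedFieldType.

Definition Gmap (phi : gvec -> gvec) : Prop :=
  exists2 g : 'M[C]_3, Gamma g & forall x, g *m embV x = embV (phi x).

Lemma Gmap_comp phi psi : Gmap phi -> Gmap psi -> Gmap (phi \o psi).
Proof.
move=> [g Gg gphi] [h Gh hpsi]; exists (g *m h); first exact: Gamma_mul.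
by move=> x; rewrite -mulmxA hpsi gphi.
Qed.

Lemma gQ_Gmap phi x y : Gmap phi -> gQ (phi x) (phi y) = gQ x y.
Proof.
case=> g [Hg _] gphi; apply: (@emb_inj C).
by rewrite -!Q_emb -!gphi Q_SU21.
Qed.

Lemma scale_Gmap phi e x : Gmap phi -> phi (gscale e x) = gscale e (phi x).
Proof.
case=> g _ gphi; apply: (@embV_inj C).
by rewrite -gphi !embV_scale -gphi scalemxAr.
Qed.

Lemma gsat_Gmap phi S : Gmap phi -> gsat (phi @` gsat S) = gsat (phi @` S).
Proof.
move=> Gphi; apply/gsatP; split=> [_ [_ [e he [x Sx <-]] <-]|].
  by rewrite scale_Gmap //; exists e => //; exists (phi x) => //; exists x.
move=> _ [x Sx <-]; apply: sub_gsat; exists x => //; exact: sub_gsat.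
Qed.

Lemma admissible_Gmap phi S : Gmap phi -> admissible S -> admissible (phi @` S).
Proof.
move=> Gphi [Sv Sb]; split=> [_ [x /Sv [xx [z zx]] <-]|_ _ [x Sx <-] [y Sy <-]].
  by rewrite (gQ_Gmap _ _ Gphi); split=> //; exists (phi z); rewrite gQ_Gmap.
by rewrite gQ_Gmap //; exact: Sb.
Qed.

Definition equivalent (S T : set gvec) : Prop :=
  exists2 phi, Gmap phi & gsat (phi @` S) = gsat T.

Lemma equivalent_trans S T U : equivalent S T -> equivalent T U -> equivalent S U.
Proof.
move=> [phi Gphi ST] [psi Gpsi TU]; exists (psi \o phi); first exact: Gmap_comp.
by rewrite -TU -(gsat_Gmap T Gpsi) -ST gsat_Gmap // image_comp.
Qed.

Lemma Gmap_equivalent phi S : Gmap phi -> equivalent S (gsat (phi @` S)).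
Proof. by move=> Gphi; exists phi; rewrite ?gsatK. Qed.

Lemma up_to_units_emb (S : set gvec) :
  up_to_units (@embV C @` S) = @embV C @` gsat S.
Proof.
apply/seteqP; split=> [_ [c /gaussunitP[e he ->] [_ [x Sx <-] <-]]|].
  by rewrite -embV_scale; exists (gscale e x) => //; exists e => //; exists x.
move=> _ [_ [e he [x Sx <-]] <-]; rewrite embV_scale; exists (emb e).
  by apply/gaussunitP; exists e.
by exists (embV x) => //; exists x.
Qed.

Lemma Gamma_conjugate_emb (S T : set gvec) :
  Gamma_conjugate (@embV C @` S) (@embV C @` T) <-> equivalent S T.
Proof.
have act g phi : (forall x, g *m embV x = embV (phi x)) ->
    up_to_units [set g *m v | v in @embV C @` S] = @embV C @` gsat (phi @` S).
  move=> gphi; rewrite -up_to_units_emb !image_comp; congr up_to_units.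
  by apply: eq_imagel => x _ /=.
split=> [[g Gg E]|[phi [g Gg gphi] E]]; last first.
  by exists g; rewrite ?(act _ _ gphi) ?up_to_units_emb ?E.
have /choice[phi gphi] : forall x, exists y, g *m embV x = embV y.
  move=> x; apply/integral_embV.
  have [_ [Zg _]] := Gg; move=> j; apply: gint_mx_mul => // {}j k.
  by rewrite ord1; apply: (integral_embV _).2; eexists.
exists phi; first by exists g.
have embI (A : set gvec) : @embV C @^-1` (@embV C @` A) = A.
  by apply/seteqP; split=> [x [y Ay /embV_inj <-]|x Ax] //; exists x.
by rewrite -[LHS]embI -[RHS]embI -(act _ _ gphi) E up_to_units_emb.
Qed.
End Transport.

(** * Sets containing a pair with unit product *)

Definition geven z : bool := let: (a +i* b)%C := z in (2 %| a + b)%Z.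

Lemma gevenP z : reflect (exists f, z = (1 + gi) * f) (geven z).
Proof.
case: z => a b; apply: (iffP dvdzP) => [[k abk]|[[c d] [-> ->]]].
  exists (k +i* (b - k))%C; congr Complex => /=; lia.
by exists c; rewrite /=; lia.
Qed.

Definition gveven x : bool :=
  let: (x1, x2, x3) := x in [&& geven x1, geven x2 & geven x3].

Lemma primitive_Nveven x : primitive x -> ~~ gveven x.
Proof.
case: x => [[x1 x2] x3] [[[z1 z2] z3] zx]; apply/negP.
case/and3P=> /gevenP[f1 E1] /gevenP[f2 E2] /gevenP[f3 E3].
move: zx; rewrite {}E1 {}E2 {}E3 => zx.
have : gN (gQ (z1, z2, z3) ((1 + gi) * f1, (1 + gi) * f2, (1 + gi) * f3)) = 1.
  by rewrite zx.
rewrite -[X in gQ _ X]/(gscale (1 + gi) (f1, f2, f3)).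
have := gQ_scale 1 (1 + gi) (z1, z2, z3) (f1, f2, f3).
by rewrite gscale1 rmorph1 mul1r => ->; rewrite gNM -[gN (1 + gi)]/(2%:Z); lia.
Qed.

Definition e1 : gvec := (1, 0, 0).
Definition e3 : gvec := (0, 0, 1).

Lemma gQ_e1 x : gQ e1 x = gi * x.2.
Proof.
by case: x => [[x1 x2] x3]; rewrite /= rmorph1 rmorph0; ring.
Qed.

Lemma gQ_e3 x : gQ e3 x = - gi * x.1.1.
Proof.
by case: x => [[x1 x2] x3]; rewrite /= rmorph1 rmorph0; ring.
Qed.

Lemma isotropic_norm x : gQ x x = 0 ->
  gN x.1.2 = 2 * (complex.Im x.1.1 * complex.Re x.2 - complex.Re x.1.1 * complex.Im x.2).
Proof.
case: x => [[[a b] [c d]] [m n]] /(congr1 (@complex.Re int)) /=; lia.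
Qed.

Definition box : seq gvec :=
  [seq (np, q) | np <- [seq (n, p) | n <- gbox [:: -1; 0; 1],
                                     p <- gbox [:: -2; -1; 0; 1; 2]],
                 q <- gbox [:: -1; 0; 1]].

Lemma mem_box x : gQ x x = 0 -> gN x.1.1 <= 2 -> gN x.2 <= 2 -> x \in box.
Proof.
move=> /isotropic_norm; case: x => -[n p] q h2 h1 h3; rewrite /= in h1 h2 h3.
apply: (allpairs_f (fun (np : gint * gint) (q : gint) => (np, q)));
  last exact: gN_small.
apply: (allpairs_f (fun n p : gint => (n, p))); first exact: gN_small.
have {h1 h2 h3} : gN p <= 4.
  case: n q h1 h2 h3 => a b [k l] /= h1 -> h3.
  by have := sqr_ge0 (b - k); have := sqr_ge0 (a + l); lia.
case: p => a b h.
have sqr_le4 (c : int) : c ^+ 2 <= 4 -> c \in [:: -2; -1; 0; 1; 2].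
  move=> h4; have h2 : -2 <= c by nia.
  have h3 : c <= 2 by nia.
  by rewrite !inE; lia.
apply: (allpairs_f (fun a b => (a +i* b)%C : gint)); apply: sqr_le4;
  by move: h; rewrite /gN; have := sqr_ge0 a; have := sqr_ge0 b; lia.
Qed.

Definition candidates : seq gvec :=
  [seq x <- box | [&& gQ x x == 0, ~~ gveven x, gN x.1.1 <= 2 & gN x.2 <= 2]].

Lemma mem_candidates x : gQ x x = 0 -> primitive x ->
  gN (gQ e1 x) <= 2 -> gN (gQ e3 x) <= 2 -> x \in candidates.
Proof.
move=> xx /primitive_Nveven px; rewrite gQ_e1 gQ_e3 !gNM.
rewrite -[gN gi]/(1%:Z) -[gN (- gi)]/(1%:Z) !mul1r => h3 h1.
by rewrite mem_filter xx px h1 h3 mem_box.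
Qed.

Definition representatives : seq gvec :=
  [seq x <- candidates | (x == e1) || (x.2 \in [:: 1; 1 + gi])].

Lemma representativesP x : x \in candidates ->
  exists2 e, e \in gunits & gscale e x \in representatives.
Proof.
have : all (fun x => has (fun e => gscale e x \in representatives) gunits) candidates.
  by vm_compute.
by move=> /allP h /h /hasP.
Qed.

Fixpoint cliques (s : seq gvec) : seq (seq gvec) :=
  if s is x :: s' then
    let c := cliques s' in
    c ++ [seq x :: t | t <- c & all (fun y => gN (gQ x y) <= 2) t]
  else [:: [::]].

Lemma filter_cliques (P : pred gvec) s :
  {in P &, forall x y, gN (gQ x y) <= 2} -> filter P s \in cliques s.
Proof.
move=> Pb; elim: s => //= x s IHs; rewrite mem_cat; case: ifP => Px; last first.
  by rewrite IHs.
rewrite map_f ?orbT // mem_filter IHs andbT.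
by apply/allP => y; rewrite mem_filter => /andP[Py _]; apply: Pb.
Qed.

Definition f2 : gvec := (gi, 1 + gi, 1 + gi).

Definition jseq : seq (seq gvec) :=
  let x := (1, 0, 1) in let y := (gi, 1 + gi, 1) in let z := (1 + gi, 1 + gi, 1) in
  [:: [:: e1; e3]; [:: e1; f2]; [:: e1; e3; x]; [:: e1; e3; y]; [:: e1; e3; z];
      [:: e1; e3; x; y]; [:: e1; e3; z; (-1, -1 + gi, 1 + gi)];
      [:: e1; e3; x; y; z]].

Definition gmem x (s : seq gvec) : bool := has (fun e => gscale e x \in s) gunits.

Definition unit_multiples (s : seq gvec) := [seq gscale e x | e <- gunits, x <- s].

Definition frames (s : seq gvec) : seq (gvec * gvec) :=
  [seq uv <- [seq (u, v) | u <- unit_multiples s, v <- unit_multiples s]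
  | [&& gQ uv.1 uv.1 == 0, gQ uv.2 uv.2 == 0 & gQ uv.1 uv.2 == gi]].

Definition moves_onto (s t : seq gvec) (uv : gvec * gvec) : bool :=
  let s' := map (gcoord uv.1 uv.2) s in
  all (gmem^~ t) s' && all (gmem^~ s') t.

Definition reducible (s : seq gvec) : bool :=
  let fs := frames s in
  has (fun t => has (moves_onto s t) fs) [seq t <- jseq | size s == size t].

Lemma cliques_reducible :
  all reducible [seq s <- cliques representatives | (e1 \in s) && (e3 \in s)].
Proof. by vm_compute. Qed.

Lemma gmemP x (s : seq gvec) : reflect (gsat [set` s] x) (gmem x s).
Proof.
apply: (iffP hasP) => [[e he ex]|[e he [y ys <-]]].
  by rewrite -(gsat_scale _ _ he); exact: sub_gsat.
by exists (gconj e); rewrite ?gunit_conj // gscaleK.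
Qed.

Lemma gsat_seq (s t : seq gvec) :
  all (gmem^~ t) s -> all (gmem^~ s) t -> gsat [set` s] = gsat [set` t].
Proof.
by move=> /allP st /allP ts; apply/gsatP; split=> x /=; [move/st/gmemP|move/ts/gmemP].
Qed.

Lemma image_seq (phi : gvec -> gvec) (s : seq gvec) :
  phi @` [set` s] = [set` map phi s].
Proof.
apply/seteqP; split=> [_ [x xs <-]|y /= /mapP[x xs ->]]; first exact: map_f.
by exists x.
Qed.

Section Reduction.
Variable C : numClosedFieldType.
Local Notation equivalent := (equivalent C).

Lemma Gmap_gcoord u v : gQ u u = 0 -> gQ v v = 0 -> gQ u v = gi ->
  Gmap C (gcoord u v).
Proof. by move=> uu vv uv; have [g Gg gE] := frame C uu vv uv; exists g. Qed.

Lemma moves_onto_equivalent (s t : seq gvec) uv : uv \in frames s ->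
  moves_onto s t uv -> equivalent [set` s] [set` t].
Proof.
rewrite mem_filter => /andP[/and3P[/eqP uu /eqP vv /eqP uv1] _] /andP[st ts].
exists (gcoord uv.1 uv.2); first exact: Gmap_gcoord.
by rewrite image_seq; exact: gsat_seq.
Qed.

Lemma reducible_equivalent (s : seq gvec) : reducible s ->
  exists2 t, t \in jseq & equivalent [set` s] [set` t].
Proof.
case/hasP=> t; rewrite mem_filter => /andP[_ tj] /hasP[uv uvs st].
by exists t => //; exact: moves_onto_equivalent uvs st.
Qed.

Lemma e1_e3_equivalent (T : set gvec) : gsat T = T -> admissible T ->
  T e1 -> T e3 -> exists2 t, t \in jseq & equivalent T [set` t].
Proof.
move=> satT [Tv Tb] Te1 Te3.
pose s := [seq x <- representatives | `[< T x >]].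
have Ts : [set` s] `<=` T by move=> x /=; rewrite mem_filter => /andP[/asboolP].
have ins x : x \in representatives -> T x -> x \in s.
  by move=> xr /asboolP Tx; rewrite mem_filter Tx.
have sT : gsat [set` s] = T.
  rewrite -satT; apply/gsatP; split=> [x /Ts|x Tx]; first by rewrite satT.
  have [xx px] := Tv x Tx.
  have [e he er] :=
    representativesP (mem_candidates xx px (Tb _ _ Te1 Tx) (Tb _ _ Te3 Tx)).
  rewrite -(gsat_scale _ _ he); apply: sub_gsat; apply: ins => //.
  by rewrite -satT gsat_scale // satT.
rewrite -sT.
have [|t tj st] := @reducible_equivalent s.
  apply: (allP cliques_reducible); rewrite mem_filter !ins // filter_cliques //.
  by move=> x y /asboolP Tx /asboolP Ty; exact: Tb.
exists t => //; have [phi Gphi E] := st.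
by exists phi; rewrite // (gsat_Gmap _ Gphi).
Qed.

Lemma gcoord_e1 u v : gQ u u = 0 -> gQ u v = gi -> gcoord u v u = e1.
Proof.
move=> uu uv; rewrite /gcoord uu -gQ_conj uv -gQ_conj gQ_perpl rmorph0 gconj_i.
by congr (_, _, _); ring: gi2.
Qed.

Lemma gcoord_e3 u v : gQ v v = 0 -> gQ u v = gi -> gcoord u v v = e3.
Proof.
move=> vv uv; rewrite /gcoord vv uv -gQ_conj gQ_perpr rmorph0.
by congr (_, _, _); ring: gi2.
Qed.

Lemma unit_pair_equivalent (S : set gvec) u v : admissible S -> S u -> S v ->
  gN (gQ u v) = 1 -> exists2 t, t \in jseq & equivalent S [set` t].
Proof.
move=> Sadm Su Sv /gunitP uv1; have Sadm' := admissible_gsat Sadm.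
have [uu _] := Sadm.1 u Su.
pose e := gi * gconj (gQ u v); have he : e \in gunits by rewrite gunitM // gunit_conj.
have Sev : gsat S (gscale e v) by apply/gsat_scale => //; exact: sub_gsat.
have [vv _] := Sadm'.1 _ Sev.
have uev : gQ u (gscale e v) = gi.
  by rewrite -[u]gscale1 gQ_scale rmorph1 mul1r /e -mulrA gunitV.
have Gphi := Gmap_gcoord uu vv uev.
have [||||t tj Tt] := @e1_e3_equivalent (gsat (gcoord u (gscale e v) @` gsat S)).
- exact: gsatK.
- exact/admissible_gsat/(admissible_Gmap Gphi).
- apply: sub_gsat; exists u; [exact: sub_gsat|exact: gcoord_e1].
- by apply: sub_gsat; exists (gscale e v) => //; exact: gcoord_e3.
exists t => //; apply: equivalent_trans Tt.
by rewrite (gsat_Gmap _ Gphi); exact: Gmap_equivalent.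
Qed.
End Reduction.

(** * Sets without such a pair *)

Lemma round_div (a N : int) : 0 < N -> exists k, - N <= 2 * (a - k * N) <= N.
Proof.
move=> N0; exists ((2 * a + N) %/ (2 * N))%Z.
have := divz_eq (2 * a + N) (2 * N); have N2 : 0 < 2 * N by lia.
have := modz_ge0 (2 * a + N) (lt0r_neq0 N2); have := ltz_pmod (2 * a + N) N2.
by move: (_ %/ _)%Z (_ %% _)%Z => k r; lia.
Qed.

Lemma geven_gN z k : gN z = 2 * k -> geven z.
Proof.
case: z => a b /= ab; apply/dvdzP.
have half (n : int) : exists m, n = 2 * m \/ n = 2 * m + 1.
  by exists (n %/ 2)%Z; lia.
have [[c hc] [d hd]] := (half a, half b).
case: hc hd ab => -> [] -> ab; [exists (c + d)|exfalso|exfalso|exists (c + d + 1)]; lia.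
Qed.

Lemma isotropic_half n p q : gQ (n, p, q) (n, p, q) = 0 ->
  exists2 f, p = (1 + gi) * f & gN f = complex.Im (n * gconj q).
Proof.
move=> /isotropic_norm /= pN.
have /gevenP[f pf] := geven_gN pN; exists f => //.
move: pN; rewrite pf gNM -[gN (1 + gi)]/(2 : int).
by case: n q f {pf} => [n1 n2] [q1 q2] [f1 f2]; rewrite /gconj /=; lia.
Qed.

(* As [k] and [r] vary, these are all isotropic vectors with last coordinate 1. *)
Definition cusp_vec (k : gint) (r : int) : gvec := ((r +i* gN k)%C, (1 + gi) * k, 1).

Lemma cusp_vec_isotropic k r : gQ (cusp_vec k r) (cusp_vec k r) = 0.
Proof. by case: k => a b; rewrite /cusp_vec /gconj /=; congr Complex => /=; ring. Qed.

(* If [m = Q(x,v)] and [N = |q|^2], then [|m|^2 N] is the norm of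
   [A + iB = i m conj(q)], and rounding twice gives [2 |A| <= N] and [2 B <= N]. *)
Lemma isotropic_descent v : gQ v v = 0 -> v.2 != 0 ->
  exists x, [/\ gQ x x = 0, x.2 = 1 & gN (gQ x v) < gN v.2].
Proof.
case: v => -[n p] q vv /= q0; have [f pE fN] := isotropic_half vv.
set N := gN q; have N0 : 0 < N by rewrite lt0r gN_eq0 q0 gN_ge0.
pose s := f * gconj q.
have [k1 hk1] := round_div (complex.Re s) N0.
have [k2 hk2] := round_div (complex.Im s) N0.
pose k : gint := (k1 +i* k2)%C.
pose m0 := n + gi * gQ (cusp_vec k 0) (0, p, q).
have [r hr] := round_div (complex.Re (m0 * gconj q)) N0.
exists (cusp_vec k r); split=> //; first exact: cusp_vec_isotropic.
have kN : 2 * gN (f - k * q) <= N.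
  have : gN (f - k * q) * N = (complex.Re s - k1 * N) ^+ 2 + (complex.Im s - k2 * N) ^+ 2.
    rewrite /s /N /k; case: (f) (q) => [f1 f2] [q1 q2]; rewrite /gconj /=; ring.
  by move: hk1 hk2 => /andP[? ?] /andP[? ?]; nia.
have := gN_ge0 (f - k * q).
set m := gQ (cusp_vec k r) (n, p, q).
have mRe : complex.Re (gi * m * gconj q) = complex.Re (m0 * gconj q) - r * N.
  rewrite /m /m0 /N; case: (n) (p) (q) => [n1 n2] [p1 p2] [q1 q2].
  by rewrite /gconj /=; ring.
have mIm : complex.Im (gi * m * gconj q) = gN (f - k * q).
  move: fN; rewrite /m pE; case: (n) (f) (q) => [n1 n2] [f1 f2] [q1 q2].
  by rewrite /gconj /=; lia.
have : gN m * N = complex.Re (gi * m * gconj q) ^+ 2 + complex.Im (gi * m * gconj q) ^+ 2.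
  by rewrite /N; case: (m) (q) => [m1 m2] [q1 q2]; rewrite /gconj /=; ring.
rewrite {}mRe {}mIm; move: (gN m) (complex.Re _ - _) (gN _) N0 hr kN => M A B.
by move=> N0 /andP[? ?] ? ? ?; nia.
Qed.

Lemma gQ_nege1 x : x.2 = 1 -> gQ x (gscale (-1) e1) = gi.
Proof. by case: x => -[n p] q /= ->; rewrite rmorph1; ring. Qed.

Lemma isotropic_e1 x : gQ x x = 0 -> primitive x -> x.2 = 0 ->
  exists2 e, e \in gunits & x = gscale e e1.
Proof.
case: x => -[n p] q xx [[[a b] c] ax] /= q0; rewrite {}q0 in xx ax *.
have p0 : p = 0.
  apply/eqP; rewrite -gN_eq0; have /= -> := isotropic_norm xx.
  by rewrite !mulr0.
exists n; last by rewrite p0 /= mulr1 !mulr0.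
have E : gQ (a, b, c) (n, 0, 0) = - gi * (gconj c * n) by rewrite /=; ring.
rewrite p0 {}E in ax; have h : gN (gconj c) * gN n = 1.
  by rewrite -gNM -[LHS]mul1r -[1]/(gN (- gi)) -gNM ax.
apply/gunitP.
move: h (gN_ge0 (gconj c)) (gN_ge0 n); move: (gN _) (gN n) => A B AB A0 B0.
have A1 : 0 < A by rewrite lt0r A0 andbT; apply: contra_eq_neq AB => ->; rewrite mul0r.
by nia.
Qed.

Lemma gcoord_scale u v e x : gcoord u v (gscale e x) = gscale e (gcoord u v x).
Proof.
have E w : gQ w (gscale e x) = e * gQ w x.
  by rewrite -[w in LHS]gscale1 gQ_scale rmorph1 mul1r.
by rewrite /gcoord /gscale !E; congr (_, _, _); ring.
Qed.

Lemma isotropic_norm2 x : gQ x x = 0 -> primitive x -> gN x.2 = 2 ->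
  exists2 e, e \in gunits & exists n f : gint,
    [/\ gscale e x = (n, (1 + gi) * f, 1 + gi), ~~ geven n
      & gN f = (complex.Im n : int) - complex.Re n].
Proof.
move=> xx px x2.
have [e he ex] : exists2 e, e \in gunits & e * x.2 = 1 + gi.
  have : x.2 \in gbox [:: -1; 0; 1] by rewrite gN_small ?x2.
  have : all (fun z => (gN z == 2) ==> has (fun e => e * z == 1 + gi) gunits)
    (gbox [:: -1; 0; 1]) by vm_compute.
  move=> /allP h /h; rewrite x2 => /hasP[e he /eqP ex].
  by exists e.
exists e => //.
have [] : gQ (gscale e x) (gscale e x) = 0 /\ primitive (gscale e x).
  by rewrite gQ_scale xx mulr0; split=> //; exact: primitive_scale.
have : (gscale e x).2 = 1 + gi by case: (x) ex => -[].
case: (gscale e x) => -[n p] q /= -> {}xx {}px.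
have [f pE fN] := isotropic_half xx; exists n, f; split; first by rewrite pE.
  have := primitive_Nveven px; rewrite /= pE; apply: contra => -> /=.
  by apply/andP; split; [apply/gevenP; exists f|].
by rewrite fN; case: (n) => a b; rewrite /gconj /=; ring.
Qed.

Lemma isotropic_norm2_move x : gQ x x = 0 -> primitive x -> gN x.2 = 2 ->
  exists2 y, gQ y y = 0 /\ gQ e1 y = gi &
    exists2 e, e \in gunits & gscale e (gcoord e1 y x) = f2.
Proof.
move=> xx px x2; have [e he [n [f [xE n1 fN]]]] := isotropic_norm2 xx px x2.
have [k fE] : exists k, f = 1 + (1 + gi) * k.
  have /gevenP[k kE] : geven (f - 1).
    case: n f n1 fN {xE} => a b [c d] /= n1 fN.
    have h : gN (((c +i* d)%C : gint) - 1) = 2 * ((b - a + 1 - 2 * c) %/ 2)%Z.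
      by move: n1 fN; rewrite /=; lia.
    exact: geven_gN h.
  by exists k; rewrite -kE; ring.
pose r : int := complex.Re (n + gi * gQ (cusp_vec k 0) (0, (1 + gi) * f, 1 + gi)).
exists (cusp_vec k r).
  by split; [exact: cusp_vec_isotropic|rewrite gQ_e1 mulr1].
exists e => //; rewrite -gcoord_scale xE.
move: fN; rewrite {}/r {}fE.
case: n k {xE n1} => a b [c d] fN.
congr (_, _, _); congr Complex; move: fN; rewrite /gconj /=; lia.
Qed.

Lemma isotropic_norm2_f2 x : gQ x x = 0 -> primitive x -> gN x.2 = 2 ->
  gN (gQ f2 x) <= 2 -> exists2 e, e \in gunits & gscale e x = f2.
Proof.
move=> xx px x2; have [e he [n [f [xE n1 fN]]]] := isotropic_norm2 xx px x2.
rewrite -(gN_Q_scale _ _ (isT : 1 \in gunits) he) gscale1 xE => Q2.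
exists e; rewrite // xE.
pose m := 1 - n - (1 - gi) * f.
have QE : gQ f2 (n, (1 + gi) * f, 1 + gi) = (1 + gi) * m.
  rewrite /m; case: (n) (f) => [a b] [c d]; rewrite /gconj /=.
  by congr Complex => /=; ring.
move: Q2; rewrite QE gNM -[gN (1 + gi)]/(2 : int) => Q2.
have /gevenP[k mk] : geven m.
  move: n1; rewrite /m; case: (n) (f) => a b [c d] /= ab; apply/dvdzP.
  by exists (((1 - a - b) %/ 2)%Z - d); lia.
have {}mk : m = 0.
  rewrite mk; have : gN k = 0.
    move: Q2; rewrite mk gNM -[gN (1 + gi)]/(2 : int).
    by have := gN_ge0 k; lia.
  by move/eqP; rewrite gN_eq0 => /eqP->; rewrite mulr0.
move: fN; have -> : n = 1 - (1 - gi) * f by rewrite -[LHS]addr0 -mk /m; ring.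
case: (f) => c d /= fN; have [-> ->] : c = 1 /\ d = 0 by nia.
by [].
Qed.

Section NoUnitPair.
Variable C : numClosedFieldType.
Local Notation Gmap := (Gmap C).
Local Notation equivalent := (equivalent C).

Lemma Gmap_inj phi : Gmap phi -> injective phi.
Proof.
move=> [g [[dg _] _] gE] x y xy; apply: (@embV_inj C).
have gu : g \in unitmx by rewrite unitmxE dg unitr1.
by rewrite -(mulKmx gu (embV x)) -(mulKmx gu (embV y)) !gE xy.
Qed.

Lemma Gmap_to_e1 x : gQ x x = 0 -> primitive x ->
  exists2 phi, Gmap phi & exists2 e, e \in gunits & phi x = gscale e e1.
Proof.
have [m] := ubnP `|gN x.2|%N; elim: m x => // m IHm x xm xx px.
have [x0|x0] := eqVneq x.2 0.
  have Gid : Gmap (gcoord e1 e3) by exact: Gmap_gcoord.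
  exists (gcoord e1 e3) => //.
  apply: isotropic_e1; first by rewrite (gQ_Gmap _ _ Gid).
    by have [z zx] := px; exists (gcoord e1 e3 z); rewrite (gQ_Gmap _ _ Gid).
  by rewrite -[LHS]/(- gi * gQ e1 x) gQ_e1 x0 !mulr0.
have [y [yy y1 yx]] := isotropic_descent xx x0.
have Gy : Gmap (gcoord y (gscale (-1) e1)).
  by apply: Gmap_gcoord; rewrite // gQ_nege1.
set psi := gcoord _ _ in Gy.
have psix : gN (psi x).2 = gN (gQ y x).
  by rewrite -[(psi x).2]/(- gi * gQ y x) gNM mul1r.
have [|||phi Gphi [e he phiE]] := IHm (psi x).
- by move: xm yx; rewrite psix ltnS; have := gN_ge0 (gQ y x); lia.
- by rewrite (gQ_Gmap _ _ Gy).
- by have [z zx] := px; exists (psi z); rewrite (gQ_Gmap _ _ Gy).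
by exists (phi \o psi); [exact: Gmap_comp | exists e].
Qed.

Lemma no_unit_pair_equivalent (S : set gvec) u v : admissible S -> S u -> S v ->
  ~ gsat [set v] u -> (forall x y, S x -> S y -> gN (gQ x y) != 1) ->
  equivalent S [set` [:: e1; f2]].
Proof.
move=> Sadm Su Sv uv S1.
have step (T : set gvec) phi : Gmap phi -> (forall x y, T x -> T y -> gN (gQ x y) != 1) ->
    forall x y, gsat (phi @` T) x -> gsat (phi @` T) y -> gN (gQ x y) != 1.
  move=> Gphi T1 _ _ [e he [_ [x Tx <-] <-]] [f hf [_ [y Ty <-] <-]].
  by rewrite gN_Q_scale // (gQ_Gmap _ _ Gphi); exact: T1.
have [uu pu] := Sadm.1 u Su.
have [phi Gphi [e he phiu]] := Gmap_to_e1 uu pu.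
set T := gsat (phi @` S); have Tadm : admissible T.
  exact/admissible_gsat/(admissible_Gmap Gphi).
have Te1 : T e1.
  by apply/(gsat_scale _ _ he); rewrite -phiu; apply: sub_gsat; exists u.
have T1 := step _ _ Gphi S1; rewrite -/T in T1.
have tail x (U : set gvec) : admissible U -> U e1 ->
    (forall y w, U y -> U w -> gN (gQ y w) != 1) -> U x ->
    (exists2 f, f \in gunits & x = gscale f e1) \/ gN x.2 = 2.
  move=> [Uv Ub] Ue1 U1 Ux; have [xx px] := Uv x Ux.
  have := U1 _ _ Ue1 Ux; have := Ub _ _ Ue1 Ux.
  rewrite gQ_e1 gNM -[gN gi]/(1 : int) mul1r => x2 x1.
  have [x0|x0] := eqVneq x.2 0; first by left; exact: isotropic_e1.
  by right; move: x0; rewrite -gN_eq0; have := gN_ge0 x.2; lia.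
have Tv : T (phi v) by apply: sub_gsat; exists v.
have [[f hf phiv]|v2] := tail _ T Tadm Te1 T1 Tv.
  case: uv; exists (e * gconj f); first by rewrite /= gunitM // gunit_conj.
  exists v => //; apply: (Gmap_inj Gphi).
  by rewrite (scale_Gmap _ _ Gphi) phiu phiv gscaleA -mulrA gunitV // mulr1.
have [vv pv] := Tadm.1 _ Tv.
have [y [yy e1y] [c hc vE]] := isotropic_norm2_move vv pv v2.
have Gpsi : Gmap (gcoord e1 y) by exact: Gmap_gcoord.
set psi := gcoord e1 y in vE Gpsi.
apply: (@equivalent_trans _ _ T); first exact: Gmap_equivalent.
exists psi => //; apply/gsatP; split; last first.
  move=> x; rewrite /= !inE => /orP[] /eqP->.
    by apply: sub_gsat; exists e1 => //; exact: gcoord_e1.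
  by exists c => //; exists (psi (phi v)); rewrite ?vE //; exists (phi v).
set U := gsat (psi @` T); have Uadm : admissible U.
  exact/admissible_gsat/(admissible_Gmap Gpsi).
have U1 := step _ _ Gpsi T1; rewrite -/U in U1.
have Ue1 : U e1 by apply: sub_gsat; exists e1 => //; exact: gcoord_e1.
have Uf2 : U f2.
  by exists c => //; exists (psi (phi v)); rewrite ?vE //; exists (phi v).
move=> x xU; have {xU} Ux : U x by exact: sub_gsat.
have [[f hf ->]|x2] := tail _ U Uadm Ue1 U1 Ux.
  by exists f => //; exists e1 => //=; rewrite inE eqxx.
have [xx px] := Uadm.1 _ Ux.
have [d hd xE] := isotropic_norm2_f2 xx px x2 (Uadm.2 _ _ Uf2 Ux).
exists (gconj d); first by rewrite /= gunit_conj.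
by exists f2; [rewrite /= !inE eqxx orbT|rewrite -xE gscaleK].
Qed.
End NoUnitPair.

(** * Pairwise inequivalence *)

Definition gT x y w : gint := gQ x y * gQ y w * gQ w x.

(* Units cancel in [gN (gQ x y)] and in the cyclic product [gT x y w]. *)
Definition compatible (p : gvec * gvec) (a : seq (gvec * gvec)) : bool :=
  all (fun q => gN (gQ p.1 q.1) == gN (gQ p.2 q.2)) a &&
  all (fun q => all (fun r => gT p.1 q.1 r.1 == gT p.2 q.2 r.2) a) a.

Fixpoint embeds (a : seq (gvec * gvec)) (s t : seq gvec) : bool :=
  if s is x :: s' then
    has (fun y => if compatible (x, y) a then embeds ((x, y) :: a) s' t else false) t
  else true.

Lemma jseq_rigid : all (fun j => all (fun k =>
  embeds [::] (nth [::] jseq j) (nth [::] jseq k) &&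
  embeds [::] (nth [::] jseq k) (nth [::] jseq j) ==> (j == k))
  (iota 0 8)) (iota 0 8).
Proof. by vm_compute. Qed.

Section Embeds.
Variable R : gvec -> gvec -> Prop.
Hypothesis RN : forall x y x' y',
  R x y -> R x' y' -> gN (gQ x x') = gN (gQ y y').
Hypothesis RT : forall x y x' y' x'' y'',
  R x y -> R x' y' -> R x'' y'' -> gT x x' x'' = gT y y' y''.

Lemma relation_embeds a s t :
  (forall x, x \in s -> exists2 y, y \in t & R x y) ->
  (forall p, p \in a -> R p.1 p.2) -> embeds a s t.
Proof.
elim: s a => //= x s IHs a sR aR; have [y yt xy] := sR x (mem_head x s).
apply/hasP; exists y => //; have -> : compatible (x, y) a.
  apply/andP; split; apply/allP => p /aR Rp; first by apply/eqP/RN.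
  by apply/allP => q /aR Rq; apply/eqP/RT.
apply: IHs => [x' x's|p]; first by apply: sR; rewrite inE x's orbT.
by rewrite inE => /predU1P[->|/aR].
Qed.
End Embeds.

Section Main.
Variable C : numClosedFieldType.
Local Notation Gmap := (Gmap C).
Local Notation equivalent := (equivalent C).

Lemma equivalent_embeds (S : set gvec) (s t : seq gvec) :
  equivalent S [set` s] -> equivalent S [set` t] -> embeds [::] s t.
Proof.
move=> [phi Gphi Ss] [psi Gpsi St].
pose R x y := exists v e f, [/\ e \in gunits, f \in gunits, x = gscale e (phi v)
  & y = gscale f (psi v)].
apply: (@relation_embeds R) => //.
- move=> _ _ _ _ [v [e [f [he hf -> ->]]]] [v' [e' [f' [he' hf' -> ->]]]].
  by rewrite !gN_Q_scale // (gQ_Gmap _ _ Gphi) (gQ_Gmap _ _ Gpsi).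
- move=> _ _ _ _ _ _ [v [e [f [he hf -> ->]]]] [v' [e' [f' [he' hf' -> ->]]]]
    [v'' [e'' [f'' [he'' hf'' -> ->]]]].
  rewrite /gT !gQ_scale !(gQ_Gmap _ _ Gphi) !(gQ_Gmap _ _ Gpsi).
  have E (a b c A B D : gint) : a \in gunits -> b \in gunits -> c \in gunits ->
      gconj a * b * A * (gconj b * c * B) * (gconj c * a * D) = A * B * D.
    move=> ha hb hc.
    transitivity ((gconj a * a) * (gconj b * b) * (gconj c * c) * (A * B * D)).
      by ring.
    by rewrite !gunitV // !mul1r.
  by rewrite !E.
move=> x xs.
have [e he [_ [v Sv <-] xE]] : gsat (phi @` S) x by rewrite Ss; exact: sub_gsat.
have [f hf [y yt yE]] : gsat [set` t] (psi v).
  by rewrite -St; apply: sub_gsat; exists v.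
exists y => //; exists v, e, (gconj f); split=> //; first by rewrite gunit_conj.
by rewrite -yE gscaleK.
Qed.

Lemma equivalent_unique (S : set gvec) j k : (j < 8)%N -> (k < 8)%N ->
  equivalent S [set` nth [::] jseq j] -> equivalent S [set` nth [::] jseq k] -> j = k.
Proof.
move=> j8 k8 Sj Sk; apply/eqP.
have /allP/(_ j) := jseq_rigid; rewrite mem_iota => /(_ j8)/allP/(_ k).
rewrite mem_iota => /(_ k8).
by rewrite (equivalent_embeds Sj Sk) (equivalent_embeds Sk Sj).
Qed.

Lemma equivalent_exists (S : set gvec) u v : admissible S -> S u -> S v ->
  ~ gsat [set v] u -> exists2 t, t \in jseq & equivalent S [set` t].
Proof.
move=> Sadm Su Sv uv.
have [[x [y [Sx Sy]]]|S1] := pselect (exists x y, [/\ S x, S y & gN (gQ x y) = 1]).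
  exact: unit_pair_equivalent.
exists [:: e1; f2]; first by [].
apply: (no_unit_pair_equivalent C Sadm Su Sv uv) => x y Sx Sy.
by apply/eqP => xy; apply: S1; exists x, y.
Qed.

Lemma Jlist_emb (k : 'I_8) : tnth (Jlist C) k = @embV C @` [set` nth [::] jseq k].
Proof.
have set2 x y s : [set` [:: x, y & s]] = [set x] `|` [set` y :: s].
  by apply/seteqP; split=> w /=; rewrite inE => /predU1P.
rewrite (tnth_nth set0); case: k => -[|[|[|[|[|[|[|[|//]]]]]]]] _ /=.
all:
  rewrite !set2 set_cons1 !image_setU !image_set1 /embV /e1 /e3 /f2
    ?(rmorphN, rmorphD) /= ?(rmorphN, rmorph0, rmorph1) /= ?emb_i.
all: rewrite /J5 /J4_1 /J4_2 /J3_1 /J3_2 /J3_3 /J2_1 /J2_2 ?setUA //.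
Qed.

Lemma reduced_emb (a : 'cV[C]_3) : reduced a -> exists2 x, a = embV x & primitive x.
Proof.
move=> [/integral_embV[x ->]] h; exists x => //.
have : coord_ideal (@embV C x) 1 by rewrite h; apply/gaussintP; exists 1; rewrite rmorph1.
move=> [_ /integral_embV[[[y1 y2] y3] ->]].
case: x {h} => -[x1 x2] x3; rewrite sum_ord3 !mxE /= => h.
exists (gi * gconj y3, - gconj y2, - gi * gconj y1); apply: (@emb_inj C).
rewrite rmorph1 -h /= !(rmorphN, rmorphM) /= !gconjK gconj_i.
rewrite !(rmorphB, rmorphN, rmorphM) /= emb_i.
have := sqrCi C; rewrite expr2 => i2.
by ring: i2.
Qed.

End Main.

Theorem proposition4p2 (R : realType) (J : set 'cV[R[i]]_3)
    (J_reduced : forall v, J v -> reduced v)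
    (J_isotropic : forall v, J v -> isotropic v)
    (J_bounded : bounded 2 J)
    (J_two : two_up_to_units J) :
  exists! k : 'I_8, Gamma_conjugate J (tnth (Jlist R[i]) k).
Proof.
pose S := @embV R[i] @^-1` J.
have JE : J = @embV R[i] @` S.
  apply/seteqP; split=> [v Jv|_ [x Sx <-] //].
  by have [x vx _] := reduced_emb (J_reduced v Jv); exists x; rewrite /S /= -?vx.
have Sadm : admissible S.
  split=> [x Sx|x y Sx Sy].
    split; last by have [y /embV_inj <-] := reduced_emb (J_reduced _ Sx).
    by apply: (@emb_inj R[i]); rewrite -Q_emb (J_isotropic _ Sx) rmorph0.
  by have := J_bounded _ _ Sx Sy; rewrite Q_emb normC_emb (ler_int _ _ 2).
have [u [v [Su Sv uv]]] : exists u v, [/\ S u, S v & ~ gsat [set v] u].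
  have [a [b [Ja Jb]]] := J_two.
  move: Ja Jb; rewrite JE => -[u Su <-] [v Sv <-] uv.
  exists u, v; split=> // ; apply: contra_not uv => uv.
  by rewrite -image_set1 up_to_units_emb; exists u.
have [t tj St] := equivalent_exists R[i] Sadm Su Sv uv.
have conjE (k : 'I_8) : Gamma_conjugate J (tnth (Jlist R[i]) k) <->
    equivalent R[i] S [set` nth [::] jseq k].
  by rewrite Jlist_emb JE; exact: Gamma_conjugate_emb.
have k8 : (index t jseq < 8)%N by rewrite -[8%N]/(size jseq) index_mem.
exists (Ordinal k8); split=> [|k /conjE Sk].
  by apply/conjE; rewrite /= nth_index.
apply/val_inj; apply: equivalent_unique Sk => //=.
by rewrite nth_index.
Qed.
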